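(* Let $\vec{v}=(0,0,1)$. Every rotational surface about the $z$-axis whose generating curve is (part of) a straight line is a $\lambda$-translator with speed $\vec{v}$ for some $\lambda\in\mathbb{R}$. In particular, these surfaces are: horizontal planes, with $|\lambda|=1$; rotational cones, with $0<|\lambda|<1$; and circular cylinders, with $\lambda=0$.
   Context: Let $\vec{v}\in\mathbb{R}^3$ with $|\vec{v}|=1$ and $\lambda\in\mathbb{R}$. An oriented surface $\Sigma$ immersed in Euclidean space $\mathbb{R}^3$, with unit normal $N$ and Gauss curvature $K$, is a $\lambda$-translator with speed $\vec{v}$ if $K=\langle N,\vec{v}\rangle+\lambda$ at every point of $\Sigma$. A rotational surface about the $z$-axis is parametrized by $\Psi(s,t)=(x(s)\cos t,x(s)\sin t,z(s))$, $s\in I$, $t\in\mathbb{R}$, where $I$ is an interval and the generating curve $\gamma(s)=(x(s),0,z(s))$ is smooth, parametrized by arc-length, with $x(s)>0$. *)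

(* Defs.v *)
From Stdlib Require Import Reals.
From Coquelicot Require Import Coquelicot.
Open Scope R_scope.

Definition R3 : Type := (R * R * R)%type.

Definition px (p : R3) : R := fst (fst p).
Definition py (p : R3) : R := snd (fst p).
Definition pz (p : R3) : R := snd p.

Definition dot (u v : R3) : R := px u * px v + py u * py v + pz u * pz v.
Definition enorm (u : R3) : R := sqrt (dot u u).
Definition cross (u v : R3) : R3 :=
  (py u * pz v - pz u * py v,
   pz u * px v - px u * pz v,
   px u * py v - py u * px v).

Definition straight_line (L : R3 -> Prop) : Prop :=
  exists p d : R3, d <> (0, 0, 0) /\
    forall q, L q <->
      exists r : R, q = (px p + r * px d, py p + r * py d, pz p + r * pz d).

(** ** Parametrized surfaces

    A parametrized surface is a map [Psi : R -> R -> R3] considered on a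
    parameter domain [U].  When [U] contains boundary points, derivatives there
    are two-sided ones, that is, smoothness on [U] refers to the given extension
    of the map across the boundary; the values on [U] of the derivatives do not
    depend on the extension for the domains [I * R] used below. *)

Definition D1 (f : R -> R -> R) (s t : R) : R := Derive (fun u => f u t) s.
Definition D2 (f : R -> R -> R) (s t : R) : R := Derive (fun u => f s u) t.

Definition continuous2_on {V : UniformSpace} (U : R -> R -> Prop)
    (f : R -> R -> V) : Prop :=
  continuous_on (fun p : R * R => U (fst p) (snd p))
                (fun p : R * R => f (fst p) (snd p)).

Fixpoint Ck_on (k : nat) (U : R -> R -> Prop) (f : R -> R -> R) : Prop :=
  continuous2_on U f /\
  match k with
  | O => True
  | S k' =>
      (forall s t, U s t ->
         ex_derive (fun u => f u t) s /\ ex_derive (fun u => f s u) t) /\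
      Ck_on k' U (D1 f) /\ Ck_on k' U (D2 f)
  end.

Definition smooth_on (U : R -> R -> Prop) (f : R -> R -> R) : Prop :=
  forall k, Ck_on k U f.

Definition dS (Psi : R -> R -> R3) (s t : R) : R3 :=
  (D1 (fun a b => px (Psi a b)) s t,
   D1 (fun a b => py (Psi a b)) s t,
   D1 (fun a b => pz (Psi a b)) s t).
Definition dT (Psi : R -> R -> R3) (s t : R) : R3 :=
  (D2 (fun a b => px (Psi a b)) s t,
   D2 (fun a b => py (Psi a b)) s t,
   D2 (fun a b => pz (Psi a b)) s t).

Definition immersion_on (U : R -> R -> Prop) (Psi : R -> R -> R3) : Prop :=
  smooth_on U (fun s t => px (Psi s t)) /\
  smooth_on U (fun s t => py (Psi s t)) /\
  smooth_on U (fun s t => pz (Psi s t)) /\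
  forall s t, U s t -> cross (dS Psi s t) (dT Psi s t) <> (0, 0, 0).

(** An orientation of the surface is the choice of such an [N]; both choices of
    sign are allowed. *)
Definition unit_normal_on (U : R -> R -> Prop) (Psi N : R -> R -> R3) : Prop :=
  continuous2_on (V := prod_UniformSpace (prod_UniformSpace R_UniformSpace R_UniformSpace)
                                         R_UniformSpace) U N /\
  forall s t, U s t ->
    enorm (N s t) = 1 /\
    dot (N s t) (dS Psi s t) = 0 /\ dot (N s t) (dT Psi s t) = 0.

(** [K = det II / det I], the two fundamental forms being taken in the basis
    [Psi_s, Psi_t]. *)
Definition gauss_curvature (Psi N : R -> R -> R3) (s t : R) : R :=
  let E := dot (dS Psi s t) (dS Psi s t) in
  let F := dot (dS Psi s t) (dT Psi s t) in
  let G := dot (dT Psi s t) (dT Psi s t) in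
  let e := dot (N s t) (dS (dS Psi) s t) in
  let f := dot (N s t) (dT (dS Psi) s t) in
  let g := dot (N s t) (dT (dT Psi) s t) in
  (e * g - f ^ 2) / (E * G - F ^ 2).

Definition translator (lambda : R) (v : R3) (U : R -> R -> Prop)
    (Psi N : R -> R -> R3) : Prop :=
  enorm v = 1 /\
  immersion_on U Psi /\
  unit_normal_on U Psi N /\
  forall s t, U s t -> gauss_curvature Psi N s t = dot (N s t) v + lambda.

Definition image (U : R -> R -> Prop) (Psi : R -> R -> R3) (p : R3) : Prop :=
  exists s t, U s t /\ p = Psi s t.

(** ** Rotational surfaces about the z-axis *)

(** Nondegenerate intervals: open, closed or half-open, bounded or not. *)
Definition interval (I : R -> Prop) : Prop :=
  (forall a b c, I a -> I b -> a <= c <= b -> I c) /\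
  exists a b, I a /\ I b /\ a < b.

Definition gen_curve (x z : R -> R) (s : R) : R3 := (x s, 0, z s).

Definition generating_curve (I : R -> Prop) (x z : R -> R) : Prop :=
  interval I /\
  forall s, I s ->
    (forall n, ex_derive_n x n s /\ ex_derive_n z n s) /\
    Derive x s ^ 2 + Derive z s ^ 2 = 1 /\
    0 < x s.

Definition rot_domain (I : R -> Prop) (s t : R) : Prop := I s.

Definition rot_surface (x z : R -> R) (s t : R) : R3 :=
  (x s * cos t, x s * sin t, z s).

Definition part_of_straight_line (I : R -> Prop) (x z : R -> R) : Prop :=
  exists L, straight_line L /\ forall s, I s -> L (gen_curve x z s).

(** ** Planes, cones and cylinders, as subsets of R3 *)

Definition horizontal_plane (S : R3 -> Prop) : Prop :=
  exists c, forall p, S p <-> pz p = c.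

(** One nappe, with apex [(0, 0, c)], of a cone of revolution about the z-axis:
    since [sqrt] is nonnegative, [m > 0] gives the upper nappe and [m < 0] the
    lower one. *)
Definition rotational_cone (S : R3 -> Prop) : Prop :=
  exists m c, m <> 0 /\
    forall p, S p <-> sqrt (px p ^ 2 + py p ^ 2) = m * (pz p - c).

Definition circular_cylinder (S : R3 -> Prop) : Prop :=
  exists r, 0 < r /\ forall p, S p <-> px p ^ 2 + py p ^ 2 = r ^ 2.

Definition part_of (kind : (R3 -> Prop) -> Prop) (A : R3 -> Prop) : Prop :=
  exists S, kind S /\ forall p, A p -> S p.

Definition on_z_axis (p : R3) : Prop := px p = 0 /\ py p = 0.

(* Main.v *)
Require Import Defs.
From Stdlib Require Import Reals Psatz FunctionalExtensionality.
From Coquelicot Require Import Coquelicot.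
Open Scope R_scope.

(** For a curve [(x, z)] of unit speed, contained in a line [A x + B z = C] of
    the half-plane, two differentiations of the line equation and one of the
    unit-speed equation give [x'' = z'' = 0].  Hence [x] and [z] are affine with
    slopes [a], [b], where [a^2 + b^2 = 1] ([straight_profile_exists]).

    The coefficients of the second fundamental form of the rotational surface
    are then [e = 0] (no acceleration along the rulings) and [f = 0], since the
    mixed derivative [Psi_st] is a multiple of the tangent vector [Psi_t].  So
    [K = 0], and the translator equation with vertical speed reduces to
    [lambda = - N_z].  A unit normal is orthogonal both to the parallel and to
    the ruling, which forces [N_z^2 = a^2] ([unit_normal_height_sq]).  As [N] is
    continuous on the connected parameter domain, [N_z] is one of the two
    constants [a], [- a] ([constant_of_constant_square]); therefore the surface
    is a translator, and every admissible [lambda] satisfies [|lambda| = |a|]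
    ([translator_constant_abs]).

    It remains to read the surface off the slopes: [b = 0] is a horizontal
    plane ([|a| = 1]), [a = 0] a cylinder, and otherwise it is a cone with
    [0 < |a| < 1].  Conversely each plane, cone and cylinder is swept, up to
    points of the axis, by an explicit affine profile; polar coordinates in
    horizontal planes show that nothing is missed ([rot_surface_image]). *)

(** * Functions on an interval with prescribed derivative *)

(** The interval contains points arbitrarily close to [s], on at least one
    side, at which the difference quotient vanishes.  Differentiability at [s]
    is two-sided, so this one side determines the derivative, including when
    [s] is an endpoint beyond which [f] is unconstrained. *)
Lemma Derive_const_on (I : R -> Prop) (f : R -> R) (c : R) :
  interval I -> (forall s, I s -> f s = c) ->
  forall s, I s -> ex_derive f s -> Derive f s = 0.
Proof.
  intros [HI [a [b [Ha [Hb Hab]]]]] Hf s Hs Hd.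
  assert (Hs1 : exists s1, I s1 /\ s1 <> s).
  { destruct (Req_dec s a) as [->|Hsa].
    - exists b; split; [exact Hb | lra].
    - exists a; split; [exact Ha | lra]. }
  destruct Hs1 as [s1 [Hs1 Hne]].
  destruct (Req_dec (Derive f s) 0) as [H0|H0]; [exact H0 | exfalso].
  apply Derive_correct, is_derive_Reals in Hd.
  destruct (Hd (Rabs (Derive f s)) (Rabs_pos_lt _ H0)) as [delta Hdelta].
  assert (Hpos := cond_pos delta).
  assert (Habs : 0 < Rabs (s1 - s)) by (apply Rabs_pos_lt; lra).
  (* the increment [k (s1 - s)] points into the interval and is below [delta] *)
  set (k := Rmin 1 (delta / 2 / Rabs (s1 - s))).
  assert (Hk0 : 0 < k).
  { unfold k; apply Rmin_glb_lt; [lra|].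
    apply Rdiv_lt_0_compat; lra. }
  assert (Hk1 : k <= 1) by apply Rmin_l.
  assert (Hkd : k * Rabs (s1 - s) < delta).
  { apply Rle_lt_trans with (delta / 2); [|lra].
    apply Rle_trans with (delta / 2 / Rabs (s1 - s) * Rabs (s1 - s)).
    - apply Rmult_le_compat_r; [lra | apply Rmin_r].
    - right; field; lra. }
  assert (Hin : I (s + k * (s1 - s))).
  { destruct (Rle_dec s s1).
    - apply (HI s s1); auto; nra.
    - apply (HI s1 s); auto; nra. }
  assert (Hh : k * (s1 - s) <> 0) by (apply Rmult_integral_contrapositive_currified; lra).
  specialize (Hdelta (k * (s1 - s)) Hh).
  rewrite Rabs_mult, (Rabs_pos_eq k) in Hdelta by lra.
  specialize (Hdelta Hkd).
  rewrite (Hf _ Hin), (Hf _ Hs) in Hdelta.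
  replace ((c - c) / (k * (s1 - s)) - Derive f s) with (- Derive f s) in Hdelta
    by (field; lra).
  rewrite Rabs_Ropp in Hdelta; lra.
Qed.

Lemma affine_of_Derive_const (I : R -> Prop) (f : R -> R) (a : R) :
  interval I -> (forall s, I s -> ex_derive f s /\ Derive f s = a) ->
  exists b, forall s, I s -> f s = b + a * s.
Proof.
  intros [HI [s0 [_ [Hs0 _]]]] Hf.
  exists (f s0 - a * s0); intros s Hs.
  assert (Hin : forall u, Rmin s0 s <= u <= Rmax s0 s -> I u).
  { unfold Rmin, Rmax; destruct (Rle_dec s0 s); intros u Hu.
    - apply (HI s0 s); auto.
    - apply (HI s s0); auto. }
  destruct (MVT_gen f s0 s (Derive f)) as [c [Hc Heq]].
  - intros u Hu; apply Derive_correct, Hf, Hin; lra.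
  - intros u Hu; apply derivable_continuous_pt, ex_derive_Reals_0, Hf, Hin; lra.
  - rewrite (proj2 (Hf c (Hin c Hc))) in Heq; lra.
Qed.

(** * Smoothness *)

(** The higher derivatives of a function stay in any class closed under
    differentiation; this spares closed formulas for the [n]-th derivatives of
    affine and trigonometric functions. *)
Lemma ex_derive_n_stable (P : (R -> R) -> Prop) :
  (forall f, P f -> P (Derive f) /\ forall s, ex_derive f s) ->
  forall n f, P f -> forall s, ex_derive_n f n s.
Proof.
  intros HP n f Hf.
  destruct n as [|n]; [intros s; exact Logic.I|].
  assert (H : P (Derive_n f n)).
  { induction n as [|n IH]; [exact Hf | apply (HP _ IH)]. }
  apply (HP _ H).
Qed.

Lemma ex_derive_n_affine (b a : R) (n : nat) (s : R) :
  ex_derive_n (fun u => b + a * u) n s.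
Proof.
  apply (ex_derive_n_stable (fun f => exists b a, f = fun u => b + a * u)); [|eauto].
  clear; intros f [b [a ->]]; split.
  - exists a, 0; apply functional_extensionality; intros s.
    apply is_derive_unique; auto_derive; [exact Logic.I | ring].
  - intros s; auto_derive; exact Logic.I.
Qed.

Lemma ex_derive_n_trig (p q : R) (n : nat) (t : R) :
  ex_derive_n (fun u => p * cos u + q * sin u) n t.
Proof.
  apply (ex_derive_n_stable
           (fun f => exists p q, f = fun u => p * cos u + q * sin u)); [|eauto].
  clear; intros f [p [q ->]]; split.
  - exists q, (- p); apply functional_extensionality; intros s.
    apply is_derive_unique; auto_derive; [exact Logic.I | ring].
  - intros s; auto_derive; exact Logic.I.
Qed.

Lemma ex_derive_n_Derive (f : R -> R) (n : nat) (s : R) :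
  ex_derive_n f (S n) s -> ex_derive_n (Derive f) n s.
Proof.
  destruct n as [|n]; [intros; exact Logic.I|].
  intros H; apply ex_derive_ext with (2 := H); intros u.
  change (Derive f) with (Derive_n f 1).
  rewrite Derive_n_comp; now rewrite Nat.add_comm.
Qed.

Lemma continuous_continuous2_on {V : UniformSpace} (U : R -> R -> Prop) (f : R -> R -> V) :
  (forall s t, U s t -> continuous (fun p : R * R => f (fst p) (snd p)) (s, t)) ->
  continuous2_on U f.
Proof.
  intros H [s t] Hst.
  apply filterlim_filter_le_1 with (2 := H s t Hst), filter_le_within.
Qed.

Lemma continuous_pair {T V W : UniformSpace} (f : T -> V) (g : T -> W) (x : T) :
  continuous f x -> continuous g x -> continuous (fun y => (f y, g y)) x.
Proof.
  intros Hf Hg; apply filterlim_locally; intros eps.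
  apply filterlim_locally with (eps := eps) in Hf.
  apply filterlim_locally with (eps := eps) in Hg.
  now apply filter_imp with (2 := filter_and _ _ Hf Hg).
Qed.

(** Both partial derivatives of a product with separated variables are again
    such products.  [Derive] is total and commutes with scalar factors at every
    point, so this is an equality of functions on the whole plane: iterated
    partial derivatives at an endpoint of [I] do not see whether [a] is
    differentiable outside [I]. *)
Lemma smooth_on_product (I : R -> Prop) (a b : R -> R) :
  (forall s, I s -> forall n, ex_derive_n a n s) ->
  (forall t n, ex_derive_n b n t) ->
  smooth_on (rot_domain I) (fun s t => a s * b t).
Proof.
  intros Ha Hb k; revert a b Ha Hb.
  induction k as [|k IH]; intros a b Ha Hb; (split; [|]); try exact Logic.I.
  1, 2: apply continuous_continuous2_on; intros s t Hs;
    apply (continuous_mult (fun p : R * R => a (fst p)) (fun p : R * R => b (snd p)));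
    [ apply (continuous_comp fst a); [apply continuous_fst|]
    | apply (continuous_comp snd b); [apply continuous_snd|] ];
    apply (ex_derive_continuous (K := R_AbsRing) (V := R_NormedModule)); [apply (Ha s Hs 1%nat) | apply (Hb t 1%nat)].
  split; [|split].
  - intros s t Hs; split.
    + apply ex_derive_mult; [apply (Ha s Hs 1%nat) | apply ex_derive_const].
    + apply ex_derive_scal, (Hb t 1%nat).
  - replace (D1 (fun s t => a s * b t)) with (fun s t => Derive a s * b t).
    + apply IH; [|exact Hb]; intros s Hs n; apply ex_derive_n_Derive, Ha, Hs.
    + do 2 (apply functional_extensionality; intro).
      unfold D1; now rewrite Derive_scal_l.
  - replace (D2 (fun s t => a s * b t)) with (fun s t => a s * Derive b t).
    + apply IH; [exact Ha|]; intros t n; apply ex_derive_n_Derive, Hb.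
    + do 2 (apply functional_extensionality; intro).
      unfold D2; now rewrite Derive_scal.
Qed.

(** * Geometry of rotational surfaces *)
Lemma Derive_cos t : Derive cos t = - sin t.
Proof. apply is_derive_unique; auto_derive; [exact Logic.I | ring]. Qed.

Lemma Derive_sin t : Derive sin t = cos t.
Proof. apply is_derive_unique; auto_derive; [exact Logic.I | ring]. Qed.

Lemma dS_rot_surface (x z : R -> R) :
  dS (rot_surface x z) = rot_surface (Derive x) (Derive z).
Proof.
  do 2 (apply functional_extensionality; intro).
  unfold dS, D1, rot_surface, px, py, pz; simpl.
  now rewrite !Derive_scal_l.
Qed.

Lemma dT_rot_surface (x z : R -> R) :
  dT (rot_surface x z) = fun s t => (- x s * sin t, x s * cos t, 0).
Proof.
  apply functional_extensionality; intro s; apply functional_extensionality; intro t.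
  unfold dT, D2, rot_surface, px, py, pz; simpl.
  rewrite !Derive_scal, Derive_const, Derive_cos, Derive_sin.
  apply f_equal2; [apply f_equal2|]; ring.
Qed.

(** [Psi_ss] vanishes, and the normal is orthogonal to [Psi_st], which is
    [x' / x] times [Psi_t]; hence [e = f = 0]. *)
Lemma gauss_curvature_straight (x z : R -> R) (N : R -> R -> R3) (s t : R) :
  0 < x s -> dot (N s t) (dT (rot_surface x z) s t) = 0 ->
  Derive (Derive x) s = 0 -> Derive (Derive z) s = 0 ->
  gauss_curvature (rot_surface x z) N s t = 0.
Proof.
  intros Hx HN Hx2 Hz2; unfold gauss_curvature.
  rewrite dT_rot_surface in HN.
  rewrite !dS_rot_surface, !dT_rot_surface.
  destruct (N s t) as [[n1 n2] n3].
  unfold dot, rot_surface, px, py, pz in *; cbn [fst snd] in *.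
  rewrite Hx2, Hz2.
  replace (n1 * (0 * cos t) + n2 * (0 * sin t) + n3 * 0) with 0 by ring.
  assert (H : n1 * - sin t + n2 * cos t = 0) by (apply (Rmult_eq_reg_l (x s)); lra).
  replace (n1 * (- Derive x s * sin t) + n2 * (Derive x s * cos t) + n3 * 0)
    with (Derive x s * (n1 * - sin t + n2 * cos t)) by ring.
  rewrite H; unfold Rdiv; ring.
Qed.

(** The vector product of the two tangent vectors has length [x], by unit
    speed. *)
Lemma immersion_rot_surface (I : R -> Prop) (x z : R -> R) :
  generating_curve I x z -> immersion_on (rot_domain I) (rot_surface x z).
Proof.
  intros [_ H].
  assert (Hcos : forall t n, ex_derive_n cos n t).
  { intros t n; apply ex_derive_n_ext with (2 := ex_derive_n_trig 1 0 n t).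
    intros u; ring. }
  assert (Hsin : forall t n, ex_derive_n sin n t).
  { intros t n; apply ex_derive_n_ext with (2 := ex_derive_n_trig 0 1 n t).
    intros u; ring. }
  unfold immersion_on, rot_surface at 1 2 3, px, py, pz; cbn [fst snd].
  split; [|split; [|split]].
  - apply smooth_on_product; [|exact Hcos]; intros s Hs n; apply (H s Hs).
  - apply smooth_on_product; [|exact Hsin]; intros s Hs n; apply (H s Hs).
  - replace (fun s _ : R => z s) with (fun s t : R => z s * (fun _ => 1) t)
      by (do 2 (apply functional_extensionality; intro); ring).
    apply smooth_on_product.
    + intros s Hs n; apply (H s Hs).
    + intros t n; apply ex_derive_n_ext with (2 := ex_derive_n_affine 1 0 n t).
      intros u; ring.
  - intros s t Hs; rewrite dS_rot_surface, dT_rot_surface.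
    destruct (H s Hs) as [_ [Hunit Hx]].
    unfold cross, rot_surface, px, py, pz; cbn [fst snd].
    intros Heq; injection Heq as H1 H2 H3.
    assert (Hsc : sin t * sin t + cos t * cos t = 1) by apply sin2_cos2.
    assert (H3' : x s * Derive x s * (sin t * sin t + cos t * cos t) = 0) by lra.
    assert (H12 : x s * Derive z s * (sin t * sin t + cos t * cos t) = 0).
    { assert (E1 : Derive z s * (x s * cos t) = 0) by lra.
      assert (E2 : Derive z s * (x s * sin t) = 0) by lra.
      transitivity (Derive z s * (x s * cos t) * cos t + Derive z s * (x s * sin t) * sin t);
        [ring | rewrite E1, E2; ring]. }
    (* [x (x', z') = 0] contradicts unit speed, as [x > 0] *)
    rewrite Hsc in H3', H12; nra.
Qed.

(** * Straight profiles are affine *)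

(** The line meets the plane of the profile either in a line, with normal
    [(d_z, - d_x)], or, if it is orthogonal to that plane, in at most one point.
    The latter is impossible for a curve of unit speed. *)
Lemma part_of_straight_line_equation (I : R -> Prop) (x z : R -> R) :
  generating_curve I x z -> part_of_straight_line I x z ->
  exists A B C, A ^ 2 + B ^ 2 <> 0 /\ forall s, I s -> A * x s + B * z s = C.
Proof.
  intros [HI H] [L [[p [d [_ HL]]] Hon]].
  exists (pz d), (- px d), (pz d * px p - px d * pz p).
  assert (Hr : forall s, I s -> exists r, x s = px p + r * px d /\ z s = pz p + r * pz d).
  { intros s Hs; destruct (proj1 (HL _) (Hon s Hs)) as [r Hr].
    exists r; injection Hr as H1 _ H3; auto. }
  split.
  - intros H0.
    assert (Hd1 : px d = 0) by nra. assert (Hd3 : pz d = 0) by nra.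
    destruct HI as [HI' [a [b [Ha Hb]]]].
    assert (HI : interval I) by (split; eauto).
    destruct (H a Ha) as [Hd [Hu _]].
    assert (Hx : Derive x a = 0).
    { apply (Derive_const_on I x (px p)); auto; [|apply (Hd 1%nat)].
      intros s Hs; destruct (Hr s Hs) as [r [-> _]]; rewrite Hd1; ring. }
    assert (Hz : Derive z a = 0).
    { apply (Derive_const_on I z (pz p)); auto; [|apply (Hd 1%nat)].
      intros s Hs; destruct (Hr s Hs) as [r [_ ->]]; rewrite Hd3; ring. }
    rewrite Hx, Hz in Hu; lra.
  - intros s Hs; destruct (Hr s Hs) as [r [-> ->]]; ring.
Qed.

(** The derivatives are recorded besides the affine formulas because at an
    endpoint of [I] these formulas hold on one side only, whereas [Derive] is
    two-sided. *)
Definition straight_profile (I : R -> Prop) (x z : R -> R) (a b x0 z0 : R) : Prop :=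
  a ^ 2 + b ^ 2 = 1 /\
  forall s, I s ->
    x s = x0 + a * s /\ z s = z0 + b * s /\
    Derive x s = a /\ Derive z s = b /\
    Derive (Derive x) s = 0 /\ Derive (Derive z) s = 0.

(** Differentiating [A x + B z = C] twice, [(x', z')] and [(x'', z'')] are both
    orthogonal to [(A, B)]; unit speed makes them orthogonal to each other as
    well, so the second one vanishes. *)
Lemma straight_profile_exists (I : R -> Prop) (x z : R -> R) :
  generating_curve I x z -> part_of_straight_line I x z ->
  exists a b x0 z0, straight_profile I x z a b x0 z0.
Proof.
  intros Hg Hl.
  destruct (part_of_straight_line_equation I x z Hg Hl) as [A [B [C [HAB Heq]]]].
  destruct Hg as [HI H].
  assert (Hd1 : forall s, I s -> ex_derive x s /\ ex_derive z s).
  { intros s Hs; exact (proj1 (H s Hs) 1%nat). }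
  assert (Hd2 : forall s, I s -> ex_derive (Derive x) s /\ ex_derive (Derive z) s).
  { intros s Hs; exact (proj1 (H s Hs) 2%nat). }
  assert (Htan : forall s, I s -> A * Derive x s + B * Derive z s = 0).
  { intros s Hs; destruct (Hd1 s Hs) as [Hx Hz].
    rewrite <- (Derive_const_on I (fun u => A * x u + B * z u) C HI Heq s Hs).
    - rewrite Derive_plus, !Derive_scal by (now apply ex_derive_scal); reflexivity.
    - apply (ex_derive_plus (V := R_NormedModule)); now apply ex_derive_scal. }
  assert (Htan2 : forall s, I s -> A * Derive (Derive x) s + B * Derive (Derive z) s = 0).
  { intros s Hs; destruct (Hd2 s Hs) as [Hx Hz].
    rewrite <- (Derive_const_on I (fun u => A * Derive x u + B * Derive z u) 0 HI Htan s Hs).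
    - rewrite Derive_plus, !Derive_scal by (now apply ex_derive_scal); reflexivity.
    - apply (ex_derive_plus (V := R_NormedModule)); now apply ex_derive_scal. }
  assert (Horth : forall s, I s ->
            Derive x s * Derive (Derive x) s + Derive z s * Derive (Derive z) s = 0).
  { intros s Hs; destruct (Hd2 s Hs) as [Hx Hz].
    assert (Hx2 := ex_derive_pow _ 2 s Hx); assert (Hz2 := ex_derive_pow _ 2 s Hz).
    assert (Hu : forall u, I u -> Derive x u ^ 2 + Derive z u ^ 2 = 1)
      by (intros u Hu; apply (H u Hu)).
    assert (H0 := Derive_const_on I (fun u => Derive x u ^ 2 + Derive z u ^ 2) 1 HI Hu s Hs
                    (ex_derive_plus (V := R_NormedModule) _ _ s Hx2 Hz2)).
    rewrite Derive_plus, !Derive_pow in H0 by assumption.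
    simpl in H0; lra. }
  assert (Hzero : forall s, I s -> Derive (Derive x) s = 0 /\ Derive (Derive z) s = 0).
  { intros s Hs.
    assert (E1 := Htan s Hs); assert (E2 := Htan2 s Hs); assert (E3 := Horth s Hs).
    assert (E4 := proj1 (proj2 (H s Hs))).
    set (p := Derive x s) in *; set (q := Derive z s) in *.
    set (p' := Derive (Derive x) s) in *; set (q' := Derive (Derive z) s) in *.
    (* up to sign, the determinant of the linear system satisfied by [(p', q')];
       by Lagrange's identity its square is [A^2 + B^2] *)
    assert (HD : A * q - B * p <> 0).
    { intros HD; apply HAB.
      replace (A ^ 2 + B ^ 2) with ((A ^ 2 + B ^ 2) * (p ^ 2 + q ^ 2)) by (rewrite E4; ring).
      replace ((A ^ 2 + B ^ 2) * (p ^ 2 + q ^ 2))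
        with ((A * q - B * p) ^ 2 + (A * p + B * q) ^ 2) by ring.
      rewrite HD, E1; ring. }
    split; apply (Rmult_eq_reg_l (A * q - B * p)); try assumption.
    - transitivity (q * (A * p' + B * q') - B * (p * p' + q * q')); [ring|].
      rewrite E2, E3; ring.
    - transitivity (A * (p * p' + q * q') - p * (A * p' + B * q')); [ring|].
      rewrite E2, E3; ring. }
  destruct (affine_of_Derive_const I (Derive x) 0 HI) as [a Ha].
  { intros s Hs; split; [apply (Hd2 s Hs) | apply (Hzero s Hs)]. }
  destruct (affine_of_Derive_const I (Derive z) 0 HI) as [b Hb].
  { intros s Hs; split; [apply (Hd2 s Hs) | apply (Hzero s Hs)]. }
  assert (Ha' : forall s, I s -> Derive x s = a) by (intros s Hs; rewrite Ha by exact Hs; ring).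
  assert (Hb' : forall s, I s -> Derive z s = b) by (intros s Hs; rewrite Hb by exact Hs; ring).
  destruct (affine_of_Derive_const I x a HI) as [x0 Hx0].
  { intros s Hs; split; [apply (Hd1 s Hs) | auto]. }
  destruct (affine_of_Derive_const I z b HI) as [z0 Hz0].
  { intros s Hs; split; [apply (Hd1 s Hs) | auto]. }
  exists a, b, x0, z0; split.
  - destruct HI as [_ [s [_ [Hs _]]]].
    rewrite <- (Ha' s Hs), <- (Hb' s Hs); apply (H s Hs).
  - intros s Hs; repeat split; auto; apply (Hzero s Hs).
Qed.

(** * The unit normal and the translator equation *)

(** By the intermediate value theorem along a segment joining two points of
    the parameter domain, [h] would vanish somewhere if it took both square
    roots of [c <> 0]. *)
Lemma constant_of_constant_square (I : R -> Prop) (h : R -> R -> R) (c : R) :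
  interval I -> continuous2_on (rot_domain I) h ->
  (forall s t, I s -> h s t ^ 2 = c) ->
  forall s t s' t', I s -> I s' -> h s t = h s' t'.
Proof.
  intros [HI _] Hh Hsq s t s' t' Hs Hs'.
  (* parametrizing the segment by [(1 - cos u) / 2] keeps [path u] inside the
     domain for every real [u], so that [h] along it is continuous on all of [R] *)
  set (path := fun u : R =>
         (s + (1 - cos u) / 2 * (s' - s), t + (1 - cos u) / 2 * (t' - t))).
  assert (HU : forall u, I (fst (path u))).
  { intros u; unfold path; cbn [fst].
    assert (Hu := COS_bound u).
    destruct (Rle_dec s s').
    - apply (HI s s'); auto; nra.
    - apply (HI s' s); auto; nra. }
  set (g := fun u => h (fst (path u)) (snd (path u))).
  assert (Hg : continuity g).
  { intros u; apply continuity_pt_filterlim.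
    assert (Hpath : continuous path u).
    { apply continuous_pair;
        apply (ex_derive_continuous (K := R_AbsRing) (V := R_NormedModule));
        auto_derive; exact Logic.I. }
    assert (Hlim := Hh (path u) (HU u)).
    apply (filterlim_comp _ _ _ path (fun p => h (fst p) (snd p))) with (2 := Hlim).
    intros P HP; unfold filtermap.
    apply (filter_imp (fun v => I (fst (path v)) -> P (path v))); [|exact (Hpath _ HP)].
    intros v Hv; apply Hv, HU. }
  assert (Hg0 : g 0 = h s t).
  { unfold g, path; cbn [fst snd]; rewrite cos_0; f_equal; field. }
  assert (Hg1 : g PI = h s' t').
  { unfold g, path; cbn [fst snd]; rewrite cos_PI; f_equal; field. }
  assert (E1 := Hsq s t Hs); assert (E2 := Hsq s' t' Hs').
  destruct (Req_dec (h s t) (h s' t')) as [He|Hne]; [exact He | exfalso].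
  assert (Hopp : h s' t' = - h s t) by nra.
  destruct (IVT_gen g 0 PI 0 Hg) as [u [_ Hu]].
  { rewrite Hg0, Hg1, Hopp; unfold Rmin, Rmax.
    destruct (Rle_dec (h s t) (- h s t)); lra. }
  assert (E3 := Hsq _ (snd (path u)) (HU u)).
  change (g u ^ 2 = c) in E3; rewrite Hu in E3; nra.
Qed.

(** Besides its component along the parallel, which is zero, the normal has a
    radial component [w] and the height [n3]; [(w, n3)] is a unit vector
    orthogonal to the unit vector [(a, b)], hence [(w, n3) = +-(- b, a)]. *)
Lemma unit_normal_height_sq (I : R -> Prop) (x z : R -> R) (N : R -> R -> R3)
    (a b x0 z0 s t : R) :
  straight_profile I x z a b x0 z0 -> I s -> 0 < x s ->
  unit_normal_on (rot_domain I) (rot_surface x z) N ->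
  pz (N s t) ^ 2 = a ^ 2.
Proof.
  intros [Hab H] Hs Hx [_ HN].
  destruct (H s Hs) as [_ [_ [Ha [Hb _]]]].
  destruct (HN s t Hs) as [H1 [H2 H3]].
  rewrite dS_rot_surface in H2; rewrite dT_rot_surface in H3.
  unfold enorm, dot, rot_surface in *.
  destruct (N s t) as [[n1 n2] n3]; unfold px, py, pz in *; cbn [fst snd] in *.
  rewrite Ha, Hb in H2.
  assert (Hnn : n1 * n1 + n2 * n2 + n3 * n3 = 1).
  { rewrite <- (sqrt_sqrt (n1 * n1 + n2 * n2 + n3 * n3)) by nra.
    rewrite H1; ring. }
  assert (Hv : - n1 * sin t + n2 * cos t = 0) by (apply (Rmult_eq_reg_l (x s)); lra).
  set (w := n1 * cos t + n2 * sin t).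
  assert (Hw : a * w + b * n3 = 0) by (unfold w; lra).
  assert (Hsc : sin t * sin t + cos t * cos t = 1) by apply sin2_cos2.
  assert (Hww : w * w + n3 * n3 = 1).
  { rewrite <- Hnn.
    replace (n1 * n1 + n2 * n2) with
      ((n1 * n1 + n2 * n2) * (sin t * sin t + cos t * cos t)) by (rewrite Hsc; ring).
    transitivity (w * w + (- n1 * sin t + n2 * cos t) ^ 2 + n3 * n3);
      [rewrite Hv | unfold w]; ring. }
  transitivity ((a ^ 2 + b ^ 2) * n3 ^ 2); [rewrite Hab; ring|].
  transitivity (a ^ 2 * n3 ^ 2 + (b * n3) ^ 2); [ring|].
  replace (b * n3) with (- (a * w)) by lra.
  transitivity (a ^ 2 * (w * w + n3 * n3)); [ring | rewrite Hww; ring].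
Qed.

Lemma unit_normal_exists (I : R -> Prop) (x z : R -> R) (a b x0 z0 : R) :
  straight_profile I x z a b x0 z0 ->
  exists N, unit_normal_on (rot_domain I) (rot_surface x z) N.
Proof.
  intros [Hab H].
  exists (fun _ t => (- b * cos t, - b * sin t, a)); split.
  - apply continuous_continuous2_on; intros s t _.
    apply continuous_pair; [apply continuous_pair|apply continuous_const];
      [ apply (continuous_comp snd (fun t => - b * cos t))
      | apply (continuous_comp snd (fun t => - b * sin t)) ];
      try apply continuous_snd;
      apply (ex_derive_continuous (K := R_AbsRing) (V := R_NormedModule));
      auto_derive; exact Logic.I.
  - intros s t Hs; rewrite dS_rot_surface, dT_rot_surface.
    destruct (H s Hs) as [_ [_ [Ha [Hb _]]]].
    unfold enorm, dot, rot_surface, px, py, pz; cbn [fst snd].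
    rewrite Ha, Hb.
    assert (Hsc : sin t * sin t + cos t * cos t = 1) by apply sin2_cos2.
    split; [|split; [|ring]].
    + replace (- b * cos t * (- b * cos t) + - b * sin t * (- b * sin t) + a * a) with 1;
        [apply sqrt_1|].
      transitivity (b ^ 2 * (sin t * sin t + cos t * cos t) + a ^ 2); [|ring].
      rewrite Hsc; lra.
    + transitivity (a * b * (1 - (sin t * sin t + cos t * cos t))); [ring|].
      rewrite Hsc; ring.
Qed.

Lemma gauss_curvature_straight_profile (I : R -> Prop) (x z : R -> R)
    (N : R -> R -> R3) (a b x0 z0 s t : R) :
  generating_curve I x z -> straight_profile I x z a b x0 z0 ->
  unit_normal_on (rot_domain I) (rot_surface x z) N -> I s ->
  gauss_curvature (rot_surface x z) N s t = 0.
Proof.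
  intros [_ Hg] [_ Hp] [_ HN] Hs.
  apply gauss_curvature_straight;
    [apply (Hg s Hs) | apply (HN s t Hs) | apply (Hp s Hs) | apply (Hp s Hs)].
Qed.

Lemma dot_vertical (n : R3) : dot n (0, 0, 1) = pz n.
Proof. destruct n as [[n1 n2] n3]; unfold dot, px, py, pz; cbn [fst snd]; ring. Qed.

Lemma translator_straight_profile (I : R -> Prop) (x z : R -> R)
    (N : R -> R -> R3) (a b x0 z0 : R) :
  generating_curve I x z -> straight_profile I x z a b x0 z0 ->
  unit_normal_on (rot_domain I) (rot_surface x z) N ->
  exists lambda, translator lambda (0, 0, 1) (rot_domain I) (rot_surface x z) N.
Proof.
  intros Hg Hp HN.
  destruct (proj1 Hg) as [_ [s0 [_ [Hs0 _]]]].
  exists (- pz (N s0 0)); split; [|split; [|split]].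
  - unfold enorm, dot, px, py, pz; cbn [fst snd].
    replace (0 * 0 + 0 * 0 + 1 * 1) with 1 by ring; apply sqrt_1.
  - now apply immersion_rot_surface.
  - exact HN.
  - intros s t Hs.
    rewrite (gauss_curvature_straight_profile I x z N a b x0 z0 s t Hg Hp HN Hs).
    rewrite dot_vertical.
    enough (pz (N s t) = pz (N s0 0)) by lra.
    apply (constant_of_constant_square I (fun s t => pz (N s t)) (a ^ 2)); auto.
    + apply (proj1 Hg).
    + intros [u v] Huv.
      apply (filterlim_comp _ _ _ (fun p => N (fst p) (snd p)) pz _ _ _
               (proj1 HN (u, v) Huv)), continuous_snd.
    + intros u v Hu.
      apply (unit_normal_height_sq I x z N a b x0 z0); auto; apply (proj2 Hg u Hu).
Qed.

Lemma translator_constant_abs (I : R -> Prop) (x z : R -> R)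
    (N : R -> R -> R3) (a b x0 z0 lambda : R) :
  generating_curve I x z -> straight_profile I x z a b x0 z0 ->
  translator lambda (0, 0, 1) (rot_domain I) (rot_surface x z) N ->
  Rabs lambda = Rabs a.
Proof.
  intros Hg Hp [_ [_ [HN HK]]].
  destruct (proj1 Hg) as [_ [s [_ [Hs _]]]].
  specialize (HK s 0 Hs).
  rewrite (gauss_curvature_straight_profile I x z N a b x0 z0 s 0 Hg Hp HN Hs),
    dot_vertical in HK.
  apply Rsqr_eq_abs_0; rewrite !Rsqr_pow2.
  rewrite <- (unit_normal_height_sq I x z N a b x0 z0 s 0); auto;
    [|apply (proj2 Hg s Hs)].
  replace lambda with (- pz (N s 0)) by lra; ring.
Qed.

(** * Planes, cones and cylinders *)
Lemma rot_surface_radius (x z : R -> R) (s t : R) :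
  px (rot_surface x z s t) ^ 2 + py (rot_surface x z s t) ^ 2 = x s ^ 2.
Proof.
  unfold rot_surface, px, py; cbn [fst snd].
  assert (Hsc : sin t * sin t + cos t * cos t = 1) by apply sin2_cos2.
  transitivity (x s ^ 2 * (sin t * sin t + cos t * cos t)); [ring | rewrite Hsc; ring].
Qed.

(** For [a] and [b] both nonzero, eliminating the parameter gives
    [x = (a / b) (z - c)] with apex height [c = z0 - b x0 / a]. *)
Lemma straight_profile_kind (I : R -> Prop) (x z : R -> R) (a b x0 z0 : R) :
  generating_curve I x z -> straight_profile I x z a b x0 z0 ->
  let A := image (rot_domain I) (rot_surface x z) in
  part_of horizontal_plane A \/ part_of rotational_cone A \/
  part_of circular_cylinder A.
Proof.
  intros [HI Hg] [Hab H] A.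
  destruct (Req_dec b 0) as [Hb|Hb]; [left|right; destruct (Req_dec a 0) as [Ha|Ha]; [right|left]].
  - exists (fun p => pz p = z0); split; [now exists z0|].
    intros p [s [t [Hs ->]]]; change (z s = z0).
    destruct (H s Hs) as [_ [-> _]]; rewrite Hb; ring.
  - exists (fun p => px p ^ 2 + py p ^ 2 = x0 ^ 2); split.
    + exists x0; split; [|intros; reflexivity].
      destruct HI as [_ [s [_ [Hs _]]]].
      assert (Hx := proj2 (proj2 (Hg s Hs))).
      rewrite (proj1 (H s Hs)), Ha in Hx; lra.
    + intros p [s [t [Hs ->]]]; rewrite rot_surface_radius.
      rewrite (proj1 (H s Hs)), Ha; ring.
  - exists (fun p => sqrt (px p ^ 2 + py p ^ 2) = a / b * (pz p - (z0 - b * x0 / a))); split.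
    + exists (a / b), (z0 - b * x0 / a); split; [|intros; reflexivity].
      apply Rmult_integral_contrapositive_currified; [exact Ha | now apply Rinv_neq_0_compat].
    + intros p [s [t [Hs ->]]]; rewrite rot_surface_radius.
      rewrite sqrt_pow2 by (apply Rlt_le, (Hg s Hs)).
      change (pz (rot_surface x z s t)) with (z s).
      destruct (H s Hs) as [-> [-> _]]; field; auto.
Qed.

(** Each kind of surface imposes a relation between [x] and [z]; comparing it at
    two parameters determines the slopes. *)
Lemma slope_of_kind (I : R -> Prop) (x z : R -> R) (a b x0 z0 : R) :
  generating_curve I x z -> straight_profile I x z a b x0 z0 ->
  let A := image (rot_domain I) (rot_surface x z) in
  (part_of horizontal_plane A -> Rabs a = 1) /\
  (part_of rotational_cone A -> 0 < Rabs a < 1) /\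
  (part_of circular_cylinder A -> a = 0).
Proof.
  intros [HI Hg] [Hab H] A.
  assert (Himg : forall s, I s -> A (rot_surface x z s 0)) by (intros s Hs; now exists s, 0).
  destruct (proj2 HI) as [s1 [s2 [Hs1 [Hs2 Hlt]]]].
  assert (P1 := proj2 (proj2 (Hg s1 Hs1))); assert (P2 := proj2 (proj2 (Hg s2 Hs2))).
  destruct (H s1 Hs1) as [X1 [Z1 _]]; destruct (H s2 Hs2) as [X2 [Z2 _]].
  split; [|split].
  - intros [S [[c Hc] HS]].
    assert (E1 := proj1 (Hc _) (HS _ (Himg s1 Hs1))).
    assert (E2 := proj1 (Hc _) (HS _ (Himg s2 Hs2))).
    change (z s1 = c) in E1; change (z s2 = c) in E2.
    assert (Hb : b = 0).
    { apply (Rmult_eq_reg_r (s2 - s1)); lra. }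
    rewrite Hb in Hab; rewrite <- Rabs_R1.
    apply Rsqr_eq_abs_0; unfold Rsqr; lra.
  - intros [S [[m [c [Hm Hc]]] HS]].
    assert (E1 := proj1 (Hc _) (HS _ (Himg s1 Hs1))).
    assert (E2 := proj1 (Hc _) (HS _ (Himg s2 Hs2))).
    rewrite rot_surface_radius, sqrt_pow2 in E1, E2 by lra.
    change (x s1 = m * (z s1 - c)) in E1; change (x s2 = m * (z s2 - c)) in E2.
    rewrite X1, Z1 in E1; rewrite X2, Z2 in E2.
    assert (Hamb : a = m * b).
    { apply (Rmult_eq_reg_r (s2 - s1)); lra. }
    assert (Hb : b <> 0).
    { intros Hb; rewrite Hamb, Hb in Hab; lra. }
    assert (Ha : a <> 0).
    { rewrite Hamb; now apply Rmult_integral_contrapositive_currified. }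
    split; [now apply Rabs_pos_lt|].
    rewrite <- Rabs_R1; apply Rsqr_lt_abs_0; unfold Rsqr.
    assert (0 < b ^ 2) by (apply pow2_gt_0; exact Hb); lra.
  - intros [S [[r [_ Hc]] HS]].
    assert (E1 := proj1 (Hc _) (HS _ (Himg s1 Hs1))).
    assert (E2 := proj1 (Hc _) (HS _ (Himg s2 Hs2))).
    rewrite rot_surface_radius in E1, E2.
    assert (E : x s1 = x s2) by nra.
    apply (Rmult_eq_reg_r (s2 - s1)); lra.
Qed.

(** * Realization by affine profiles *)
Lemma polar_coordinates (u v : R) :
  ~ (u = 0 /\ v = 0) ->
  0 < sqrt (u ^ 2 + v ^ 2) /\
  exists t, u = sqrt (u ^ 2 + v ^ 2) * cos t /\ v = sqrt (u ^ 2 + v ^ 2) * sin t.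
Proof.
  intros Huv.
  assert (Hpos : 0 < u ^ 2 + v ^ 2).
  { destruct (Req_dec u 0) as [Hu|Hu].
    - assert (0 < v ^ 2) by (apply pow2_gt_0; tauto). nra.
    - assert (0 < u ^ 2) by (now apply pow2_gt_0). nra. }
  assert (Hr := sqrt_lt_R0 _ Hpos); split; [exact Hr|].
  assert (Hrr := sqrt_sqrt _ (Rlt_le _ _ Hpos)).
  set (r := sqrt (u ^ 2 + v ^ 2)) in *.
  assert (Hc : -1 <= u / r <= 1).
  { split; [apply Rle_div_r | apply Rle_div_l]; nra. }
  assert (Hs : 1 - (u / r)^2 = (v / r)^2).
  { field_simplify_eq; nra. }
  assert (Hsin : sin (acos (u / r)) = Rabs (v / r)).
  { rewrite sin_acos by exact Hc; rewrite Rsqr_pow2, Hs, <- Rsqr_pow2; apply sqrt_Rsqr_abs. }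
  destruct (Rle_dec 0 v) as [Hv|Hv].
  - exists (acos (u / r)); rewrite cos_acos, Hsin by exact Hc.
    rewrite Rabs_pos_eq by (apply Rdiv_le_0_compat; lra).
    split; field; lra.
  - exists (- acos (u / r)); rewrite cos_neg, sin_neg, cos_acos, Hsin by exact Hc.
    rewrite Rabs_left by (apply Rlt_div_l; lra).
    split; field; lra.
Qed.

(** The rotation carries the point of the profile with the radius and height of
    [p] to [p] itself, so the last hypothesis only has to match these two
    numbers. *)
Lemma rot_surface_image (I : R -> Prop) (x z : R -> R) (S : R3 -> Prop) :
  (forall s, I s -> 0 < x s) ->
  (forall s t, I s -> S (rot_surface x z s t)) ->
  (forall p, S p -> ~ on_z_axis p ->
     exists s, I s /\ x s = sqrt (px p ^ 2 + py p ^ 2) /\ z s = pz p) ->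
  forall p, image (rot_domain I) (rot_surface x z) p <-> S p /\ ~ on_z_axis p.
Proof.
  intros Hx HS Hback p; split.
  - intros [s [t [Hs ->]]]; split; [now apply HS|].
    intros [Hpx Hpy]; assert (Hr := rot_surface_radius x z s t).
    rewrite Hpx, Hpy in Hr; assert (Hp := Hx s Hs); nra.
  - intros [Hp Hax]; destruct (Hback p Hp Hax) as [s [Hs [Hxs Hzs]]].
    destruct (polar_coordinates (px p) (py p) Hax) as [_ [t [Hu Hv]]].
    exists s, t; split; [exact Hs|].
    unfold rot_surface; rewrite Hxs, Hzs, <- Hu, <- Hv.
    now destruct p as [[p1 p2] p3].
Qed.

Lemma affine_profile (I : R -> Prop) (a b x0 z0 : R) :
  interval I -> a ^ 2 + b ^ 2 = 1 -> (forall s, I s -> 0 < x0 + a * s) ->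
  generating_curve I (fun s => x0 + a * s) (fun s => z0 + b * s) /\
  part_of_straight_line I (fun s => x0 + a * s) (fun s => z0 + b * s).
Proof.
  intros HI Hab Hpos; split.
  - split; [exact HI|]; intros s Hs; split; [|split; [|now apply Hpos]].
    + intros n; split; apply ex_derive_n_affine.
    + assert (HD : forall p q, Derive (fun u => p + q * u) s = q).
      { intros p q; apply is_derive_unique; auto_derive; [exact Logic.I | ring]. }
      now rewrite !HD.
  - exists (fun q => exists r, q = (x0 + r * a, 0 + r * 0, z0 + r * b)); split.
    + exists (x0, 0, z0), (a, 0, b); split; [|intros q; reflexivity].
      intros H; injection H as Ha Hb; rewrite Ha, Hb in Hab; lra.
    + intros s _; exists s; unfold gen_curve; apply f_equal2; [apply f_equal2|]; ring.
Qed.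

Lemma interval_pos : interval (fun s => 0 < s).
Proof. split; [intros; lra | exists 1, 2; lra]. Qed.

Lemma horizontal_plane_profile (S : R3 -> Prop) :
  horizontal_plane S ->
  exists (I : R -> Prop) (x z : R -> R),
    generating_curve I x z /\ part_of_straight_line I x z /\
    forall p, image (rot_domain I) (rot_surface x z) p <-> S p /\ ~ on_z_axis p.
Proof.
  intros [c Hc].
  destruct (affine_profile (fun s => 0 < s) 1 0 0 c) as [H1 H2];
    [exact interval_pos | ring | intros; lra |].
  do 3 eexists; split; [exact H1|]; split; [exact H2|].
  apply rot_surface_image.
  - intros; lra.
  - intros s t _; apply Hc; unfold rot_surface, pz; cbn [snd]; ring.
  - intros p Hp Hax; exists (sqrt (px p ^ 2 + py p ^ 2)); split; [|split].
    + now apply polar_coordinates.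
    + ring.
    + rewrite (proj1 (Hc p) Hp); ring.
Qed.

(** The profile has slopes [a = |m| / sqrt (1 + m^2)] and [a / m]: starting at
    the apex, the radius increases with the parameter, while the height moves in
    the direction given by the sign of [m]. *)
Lemma rotational_cone_profile (S : R3 -> Prop) :
  rotational_cone S ->
  exists (I : R -> Prop) (x z : R -> R),
    generating_curve I x z /\ part_of_straight_line I x z /\
    forall p, image (rot_domain I) (rot_surface x z) p <-> S p /\ ~ on_z_axis p.
Proof.
  intros [m [c [Hm Hc]]].
  set (q := sqrt (1 + m ^ 2)).
  assert (Hm2 : 0 < m ^ 2) by (now apply pow2_gt_0).
  assert (Hq : 0 < q) by (apply sqrt_lt_R0; lra).
  assert (Hqq : q * q = 1 + m ^ 2) by (apply sqrt_sqrt; lra).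
  set (a := Rabs m / q).
  assert (Ha : 0 < a) by (apply Rdiv_lt_0_compat; [now apply Rabs_pos_lt | exact Hq]).
  destruct (affine_profile (fun s => 0 < s) a (a / m) 0 c) as [H1 H2].
  { exact interval_pos. }
  { unfold a. replace ((Rabs m / q) ^ 2 + (Rabs m / q / m) ^ 2)
      with ((Rabs m) ^ 2 * (1 + m ^ 2) / (m ^ 2 * (q * q))) by (field; lra).
    rewrite pow2_abs, Hqq; field; nra. }
  { intros s Hs; nra. }
  do 3 eexists; split; [exact H1|]; split; [exact H2|].
  apply rot_surface_image.
  - intros s Hs; nra.
  - intros s t Hs; apply Hc; rewrite rot_surface_radius, sqrt_pow2 by nra.
    unfold rot_surface, pz; cbn [snd]; field; exact Hm.
  - intros p Hp Hax; exists (sqrt (px p ^ 2 + py p ^ 2) / a); split; [|split].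
    + apply Rdiv_lt_0_compat; [now apply polar_coordinates | exact Ha].
    + field; lra.
    + rewrite (proj1 (Hc p) Hp); field; lra.
Qed.

Lemma circular_cylinder_profile (S : R3 -> Prop) :
  circular_cylinder S ->
  exists (I : R -> Prop) (x z : R -> R),
    generating_curve I x z /\ part_of_straight_line I x z /\
    forall p, image (rot_domain I) (rot_surface x z) p <-> S p /\ ~ on_z_axis p.
Proof.
  intros [r [Hr Hc]].
  destruct (affine_profile (fun _ => True) 0 1 r 0) as [H1 H2];
    [split; [auto | exists 0, 1; lra] | ring | intros; lra |].
  do 3 eexists; split; [exact H1|]; split; [exact H2|].
  apply rot_surface_image.
  - intros; lra.
  - intros s t _; apply Hc; rewrite rot_surface_radius; ring.
  - intros p Hp Hax; exists (pz p); split; [exact Logic.I | split; [|ring]].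
    rewrite (proj1 (Hc p) Hp), sqrt_pow2 by lra; ring.
Qed.

Theorem proposition3p2 :
  (forall (I : R -> Prop) (x z : R -> R),
     generating_curve I x z ->
     part_of_straight_line I x z ->
     let U := rot_domain I in
     let Psi := rot_surface x z in
     let A := image U Psi in
     (exists N, unit_normal_on U Psi N) /\
     (forall N, unit_normal_on U Psi N ->
        exists lambda : R, translator lambda (0, 0, 1) U Psi N) /\
     (part_of horizontal_plane A \/ part_of rotational_cone A \/
      part_of circular_cylinder A) /\
     (forall N (lambda : R), translator lambda (0, 0, 1) U Psi N ->
        (part_of horizontal_plane A -> Rabs lambda = 1) /\
        (part_of rotational_cone A -> 0 < Rabs lambda < 1) /\
        (part_of circular_cylinder A -> lambda = 0))) /\
  (forall S : R3 -> Prop,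
     horizontal_plane S \/ rotational_cone S \/ circular_cylinder S ->
     exists (I : R -> Prop) (x z : R -> R),
       generating_curve I x z /\
       part_of_straight_line I x z /\
       forall p : R3,
         image (rot_domain I) (rot_surface x z) p <-> S p /\ ~ on_z_axis p).
Proof.
  split.
  - intros I x z Hg Hl U Psi A.
    destruct (straight_profile_exists I x z Hg Hl) as [a [b [x0 [z0 Hp]]]].
    split; [|split; [|split]].
    + exact (unit_normal_exists I x z a b x0 z0 Hp).
    + intros N HN; exact (translator_straight_profile I x z N a b x0 z0 Hg Hp HN).
    + exact (straight_profile_kind I x z a b x0 z0 Hg Hp).
    + intros N lambda HT.
      assert (Hlam := translator_constant_abs I x z N a b x0 z0 lambda Hg Hp HT).
      destruct (slope_of_kind I x z a b x0 z0 Hg Hp) as [Hpl [Hco Hcy]].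
      split; [|split]; intros Hk.
      * rewrite Hlam; now apply Hpl.
      * rewrite Hlam; now apply Hco.
      * rewrite (Hcy Hk), Rabs_R0 in Hlam.
        destruct (Req_dec lambda 0) as [H0|H0]; [exact H0|].
        now apply Rabs_no_R0 in H0.
  - intros S [HS|[HS|HS]].
    + now apply horizontal_plane_profile.
    + now apply rotational_cone_profile.
    + now apply circular_cylinder_profile.
Qed.
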